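(* Let $(A,\mathbf{B},\delta)$ be a non-homogeneous $C$-algebra arising from an Allen matrix $s$ of rank $4$, with standard basis $\mathbf{B}=\{b_0,b_1,b_2,b_3\}$. Then $s$ is not an integral Fourier matrix. In other words, there is no non-homogeneous $C$-algebra of rank $4$ arising from an integral Fourier matrix.
   Context: Fourier and Allen matrices: rows and columns of $r\times r$ matrices are indexed by $0,1,\dots,r-1$. A Fourier matrix of rank $r$ is a complex $r\times r$ matrix $S$ that is unitary and symmetric, has $S_{i0}>0$ for all $i$, and satisfies $N_{ijk}=\sum_l S_{li}S_{lj}\overline{S_{lk}}\,S_{l0}^{-1}\in\mathbb{Z}$ for all $i,j,k$. The associated Allen matrix is $s=[s_{ij}]$ with $s_{ij}=S_{ij}/S_{i0}$. $C$-algebra arising from $s$: put $P=[p_{ij}]$ with $p_{ij}=s_{ij}s_{0j}$, let $b_j\in\mathbb{C}^r$ be the $j$-th column of $P$, $\mathbf{B}=\{b_0,\dots,b_{r-1}\}$, and let $A$ be the $\mathbb{C}$-span of $\mathbf{B}$ with componentwise multiplication, whose identity is $b_0$. The involution on $A$ is entrywise complex conjugation, and it maps $\mathbf{B}$ to itself. The degree map $\delta:A\to\mathbb{C}$ is the algebra homomorphism giving the $0$-th coordinate, so $\delta(b_j)=p_{0j}=s_{0j}^2>0$. The triple $(A,\mathbf{B},\delta)$ is the $C$-algebra arising from the Allen matrix $s$; $\mathbf{B}$ is its standard basis, $r$ its rank. It is called homogeneous if there is $k\in\mathbb{Z}^+$ with $\delta(b_i)=k$ for all $1\le i\le r-1$,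 and non-homogeneous otherwise. Integral Fourier matrix: an $r\times r$ matrix $s$ with integer entries such that (1) $s_{i0}=1$ for all $i$ and $\det s\ne0$; (2) $ss^T=\mathrm{diag}(d_0,\dots,d_{r-1})$ with $d_i=\sum_js_{ij}^2$; (3) $\sqrt{d_j}\,s_{ij}=\sqrt{d_i}\,s_{ji}$ for all $i,j$; (4) $\sum_l s_{li}s_{lj}s_{lk}d_l^{-1}\in\mathbb{Z}$ for all $i,j,k$. Such an $s$ is an Allen matrix, with Fourier matrix $S_{ij}=s_{ij}/\sqrt{d_i}$. *)

(* Defs.v *)
From HB Require Import structures.
From mathcomp Require Import all_boot all_order all_algebra.
From mathcomp Require Import spectral complex reals.

Set Implicit Arguments.
Unset Strict Implicit.
Unset Printing Implicit Defensive.

Import Order.TTheory GRing.Theory Num.Theory.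
Local Open Scope ring_scope.

Section Matrices.
Variables (C : numClosedFieldType) (n : nat).
Implicit Types S s : 'M[C]_n.+1.

Definition is_integer (x : C) : Prop := exists m : int, x = m%:~R.

(* The order on C is partial: 0 < x means that x is real and positive. *)
Definition fourier S : Prop :=
  [/\ S \is unitarymx, S^T = S, forall i, 0 < S i ord0 &
      forall i j k,
        is_integer (\sum_l S l i * S l j * (S l k)^* * (S l ord0)^-1)].

Definition allen_mx S : 'M[C]_n.+1 := \matrix_(i, j) (S i j / S i ord0).

Definition allen s : Prop := exists2 S, fourier S & s = allen_mx S.

Definition row_norm2 s (i : 'I_n.+1) : C := \sum_j s i j ^+ 2.

Definition integral_fourier s : Prop :=
  [/\ forall i j, is_integer (s i j),
      (forall i, s i ord0 = 1) /\ \det s != 0,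
      s *m s^T = diag_mx (\row_i row_norm2 s i),
      forall i j,
        sqrtC (row_norm2 s j) * s i j = sqrtC (row_norm2 s i) * s j i &
      forall i j k,
        is_integer (\sum_l s l i * s l j * s l k * (row_norm2 s l)^-1)].

End Matrices.

(* An algebra of column vectors with its standard basis and degree map; the  *)
(* index 0 of the basis is that of the identity.                             *)
Record calgebra (C : numClosedFieldType) (n : nat) := CAlgebra {
  calg_space : {vspace 'cV[C]_n.+1};
  calg_mul : subvs_of calg_space -> subvs_of calg_space -> subvs_of calg_space;
  calg_conj : subvs_of calg_space -> subvs_of calg_space;
  calg_basis : 'I_n.+1 -> subvs_of calg_space;
  calg_degree : subvs_of calg_space -> C
}.

Definition homogeneous (C : numClosedFieldType) (n : nat)
    (A : calgebra C n) : Prop :=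
  exists2 k : nat, (0 < k)%N &
    forall i : 'I_n.+1, i != ord0 ->
      calg_degree (calg_basis A i) = k%:R.

Section Arising.
Variables (C : numClosedFieldType) (n : nat) (s : 'M[C]_n.+1).

Definition p_mx : 'M[C]_n.+1 := \matrix_(i, j) (s i j * s ord0 j).

Definition arising_space : {vspace 'cV[C]_n.+1} :=
  <<[seq col j p_mx | j : 'I_n.+1]>>%VS.

(* vsproj only casts a vector of the span into the subtype: see              *)
(* arising_basisE, arising_mulE and arising_conjE below.                     *)
Definition arising_mul (x y : subvs_of arising_space) :
    subvs_of arising_space :=
  vsproj arising_space (map2_mx *%R (vsval x) (vsval y)).

Definition arising_conj (x : subvs_of arising_space) :
    subvs_of arising_space :=
  vsproj arising_space (map_mx Num.conj (vsval x)).

Definition arising_basis (j : 'I_n.+1) : subvs_of arising_space :=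
  vsproj arising_space (col j p_mx).

Definition arising_degree (x : subvs_of arising_space) : C :=
  vsval x ord0 ord0.

Definition arising_calgebra : calgebra C n :=
  CAlgebra arising_mul arising_conj arising_basis arising_degree.

Lemma arising_basisE j : vsval (arising_basis j) = col j p_mx.
Proof.
by rewrite vsprojK // memv_span //; apply/mapP; exists j; rewrite ?mem_enum.
Qed.

Lemma arising_degree_basis j :
  arising_degree (arising_basis j) = s ord0 j ^+ 2.
Proof. by rewrite /arising_degree arising_basisE !mxE. Qed.

Lemma arising_space_full :
  \det s != 0 -> (forall j, s ord0 j != 0) ->
  forall v, v \in arising_space.
Proof.
move=> det0 s0.
have det_p : p_mx \in unitmx.
  rewrite unitmxE unitfE.
  have ->: p_mx = s *m diag_mx (\row_j s ord0 j).
    by apply/matrixP => i j; rewrite mul_mx_diag !mxE.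
  rewrite det_mulmx det_diag mulf_neq0 //.
  by apply/prodf_neq0 => j _; rewrite mxE.
move=> v; rewrite -[v](mulKVmx det_p); set w := invmx _ *m v.
have ->: p_mx *m w = \sum_j w j ord0 *: col j p_mx.
  apply/matrixP => i k; rewrite ord1 summxE mxE.
  by apply: eq_bigr => j _; rewrite !mxE mulrC.
apply: memv_suml => j _; apply: memvZ; rewrite memv_span //.
by apply/mapP; exists j; rewrite ?mem_enum.
Qed.

End Arising.

Lemma allen_det (C : numClosedFieldType) (n : nat) (s : 'M[C]_n.+1) :
  allen s -> \det s != 0 /\ forall j, s ord0 j != 0.
Proof.
move=> [S [uS symS S0 _] ->]; split; last first.
  move=> j; have ->: allen_mx S ord0 j = S j ord0 / S ord0 ord0.
    by rewrite -{2}symS !mxE.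
  by rewrite mulf_neq0 ?invr_eq0 ?gt_eqF.
have ->: allen_mx S = diag_mx (\row_i (S i ord0)^-1) *m S.
  by apply/matrixP => i j; rewrite mul_diag_mx !mxE mulrC.
rewrite det_mulmx det_diag mulf_neq0 //.
  by apply/prodf_neq0 => j _; rewrite mxE invr_eq0 gt_eqF.
by rewrite -unitfE -unitmxE; apply: unitarymx_unit.
Qed.

Lemma arising_mulE (C : numClosedFieldType) (n : nat) (s : 'M[C]_n.+1) :
  allen s -> forall x y : subvs_of (arising_space s),
    vsval (arising_mul x y) = map2_mx *%R (vsval x) (vsval y).
Proof.
by move=> /allen_det[? ?] x y; rewrite vsprojK // arising_space_full.
Qed.

Lemma arising_conjE (C : numClosedFieldType) (n : nat) (s : 'M[C]_n.+1) :
  allen s -> forall x : subvs_of (arising_space s),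
    vsval (arising_conj x) = map_mx Num.conj (vsval x).
Proof.
by move=> /allen_det[? ?] x; rewrite vsprojK // arising_space_full.
Qed.

Lemma arising_mul1 (C : numClosedFieldType) (n : nat) (s : 'M[C]_n.+1) :
  allen s -> forall x : subvs_of (arising_space s),
    arising_mul (arising_basis s ord0) x = x.
Proof.
move=> als x; apply: val_inj; rewrite /= arising_mulE // arising_basisE.
have s0 i : s i ord0 = 1.
  by case: als => S [_ _ S0 _] ->; rewrite mxE divff // gt_eqF.
by apply/matrixP => i j; rewrite ord1 !mxE !s0 !mul1r.
Qed.

Lemma integral_fourier_allen (C : numClosedFieldType) (n : nat)
    (s : 'M[C]_n.+1) : integral_fourier s -> allen s.
Proof.
case=> sint [s0 _] sT sym N.
have sreal i j : (s i j)^* = s i j by have [m ->] := sint i j; rewrite rmorph_int.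
have d_gt0 i : 0 < row_norm2 s i.
  rewrite /row_norm2 (bigD1 ord0) //= s0 expr1n ltr_pwDl // sumr_ge0 // => j _.
  have [m ->] := sint i j.
  by rewrite -realEsqr realz.
pose q i := sqrtC (row_norm2 s i).
have q_gt0 i : 0 < q i by rewrite sqrtC_gt0.
have q0 i : q i != 0 by rewrite gt_eqF.
have qq i : q i * q i = row_norm2 s i by rewrite -expr2 sqrtCK.
pose S := \matrix_(i, j) (s i j / q i) : 'M[C]_n.+1.
have qreal i : (q i)^* = q i by apply/CrealP; rewrite gtr0_real.
exists S => //; last first.
  by apply/matrixP => i j; rewrite !mxE s0 div1r invrK divfK.
split.
- apply/unitarymxP/matrixP => i j; rewrite !mxE.
  transitivity ((s *m s^T) i j / (q i * q j)).
    rewrite mxE mulr_suml; apply: eq_bigr => k _.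
    by rewrite !mxE rmorphM fmorphV /= sreal qreal invfM mulrACA.
  rewrite sT !mxE; case: eqVneq => [->|_]; last by rewrite mul0r.
  by rewrite qq !mulr1n divff // gt_eqF.
- apply/matrixP => i j; rewrite !mxE.
  apply: (mulIf (q0 i)); apply: (mulIf (q0 j)).
  by rewrite divfK // mulrAC divfK // mulrC [RHS]mulrC; apply/esym/sym.
- by move=> i; rewrite mxE s0 div1r invr_gt0.
move=> i j k; have [m Em] := N i j k; exists m; rewrite -Em.
apply: eq_bigr => l _; rewrite !mxE rmorphM fmorphV /= sreal qreal s0 div1r.
rewrite invrK -qq invfM !mulrA.
rewrite (mulrAC _ (q l)^-1 (s l j)) (mulrAC _ (q l)^-1 (s l k)).
by rewrite (mulrAC _ (q l)^-1 (s l k)) -[_ / q l * q l]mulrA mulVf // mulr1.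
Qed.

(* Main.v *)
(** The relation sqrt(d_0) s_i0 = sqrt(d_i) s_0i squares to d_0 = d_i s_0i^2,
    so, writing a, b, c for |s_01|, |s_02|, |s_03|, each of a^2, b^2, c^2
    divides d_0 = 1 + a^2 + b^2 + c^2.  If one of a, b, c were even then 4
    would divide d_0, which modulo 4 forces all three to be odd.  Hence a, b, c
    are odd; if c is the largest then 1 + a^2 + b^2 = m c^2 with m <= 3 and
    m = 3 modulo 4, so m = 3 and a = b = c = 1.  Thus every C-algebra of rank 4
    arising from an integral Fourier matrix is homogeneous. *)
Require Import Defs.
From mathcomp Require Import all_boot all_order all_algebra.
From mathcomp Require Import complex reals zify.

Set Implicit Arguments.
Unset Strict Implicit.
Unset Printing Implicit Defensive.

Import Order.TTheory GRing.Theory Num.Theory.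

Local Open Scope ring_scope.

Lemma sqrn_mod4 a : (a ^ 2 = odd a %[mod 4])%N.
Proof.
rewrite -modnXm; have: (a %% 4 < 4)%N by rewrite ltn_mod.
(* Parity survives reduction modulo 4, so only four residues remain. *)
rewrite -[odd a](odd_mod a (erefl (odd 4))).
by case: (a %% 4)%N => [|[|[|[|]]]].
Qed.

Lemma odd_sqr_dvdn_sum a b c :
  (a ^ 2 %| 1 + a ^ 2 + b ^ 2 + c ^ 2)%N -> odd a.
Proof.
move=> dvd_n; apply: contraT => even_a.
have: (4 %| 1 + a ^ 2 + b ^ 2 + c ^ 2)%N.
  by apply: dvdn_trans dvd_n; rewrite (@dvdn_exp2r 2 a 2) ?dvdn2.
(* With [a] even, the sum is 1, 2 or 3 modulo 4, according to the parities of [b] and [c]. *)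
have := (sqrn_mod4 a, sqrn_mod4 b, sqrn_mod4 c); rewrite (negbTE even_a).
by case: (odd b); case: (odd c) => -[[]]; lia.
Qed.

Lemma max_sqr_dvdn_sum a b c :
    odd a -> odd b -> odd c -> (a <= c)%N -> (b <= c)%N ->
    (c ^ 2 %| 1 + a ^ 2 + b ^ 2 + c ^ 2)%N ->
  [/\ a = 1, b = 1 & c = 1]%N.
Proof.
move=> odd_a odd_b odd_c le_ac le_bc.
have := (sqrn_mod4 a, sqrn_mod4 b, sqrn_mod4 c).
rewrite odd_a odd_b odd_c => -[[a4 b4] c4].
rewrite dvdn_addl // => /dvdnP[m Em].
have le_ac2 : (a ^ 2 <= c ^ 2)%N by rewrite leq_sqr.
have le_bc2 : (b ^ 2 <= c ^ 2)%N by rewrite leq_sqr.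
have c_gt0 : (0 < c ^ 2)%N by rewrite expn_gt0 odd_gt0.
(* Since [c ^ 2] is 1 modulo 4, [m] is congruent to [m * c ^ 2], that is, to [1 + a ^ 2 + b ^ 2]. *)
have m4 : (m = 3 %[mod 4])%N.
  by rewrite -[m]muln1 -modnMmr -[(1 %% 4)%N]c4 modnMmr -Em; lia.
(* Each of 1, [a ^ 2] and [b ^ 2] is at most [c ^ 2]. *)
have m_le3 : (m <= 3)%N by rewrite -(leq_pmul2r c_gt0) -Em; lia.
have m3 : m = 3%N by lia.
rewrite m3 in Em.
(* Now three terms, each at most [c ^ 2], add up to [3 * c ^ 2], so all of them equal [c ^ 2], and
   one of them is 1. *)
have [a1 b1 c1] : [/\ a ^ 2 = 1 ^ 2, b ^ 2 = 1 ^ 2 & c ^ 2 = 1 ^ 2]%N.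
  by rewrite exp1n; split; lia.
by split; apply/eqP; rewrite -eqn_sqr; apply/eqP.
Qed.

Lemma sqr_dvdn_sum_eq1 a b c :
    let n := (1 + a ^ 2 + b ^ 2 + c ^ 2)%N in
    (a ^ 2 %| n)%N -> (b ^ 2 %| n)%N -> (c ^ 2 %| n)%N ->
  [/\ a = 1, b = 1 & c = 1]%N.
Proof.
move=> n an; rewrite {}/n in an * => bn cn.
have bn' : (b ^ 2 %| 1 + a ^ 2 + c ^ 2 + b ^ 2)%N by rewrite addnAC.
have an' : (a ^ 2 %| 1 + b ^ 2 + c ^ 2 + a ^ 2)%N by rewrite addnAC (addnAC 1%N).
have oa := odd_sqr_dvdn_sum an.
have ob : odd b by apply: (@odd_sqr_dvdn_sum b a c); rewrite (addnAC 1%N).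
have oc : odd c by apply: (@odd_sqr_dvdn_sum c a b); rewrite (addnAC 1%N) addnAC.
(* The hypotheses are symmetric in [a], [b], [c]; the comparisons select a largest one to play the
   role of [c]. *)
have [le_ab|/ltnW le_ba] := leqP a b.
  have [le_bc|/ltnW le_cb] := leqP b c.
    exact: max_sqr_dvdn_sum (leq_trans le_ab le_bc) le_bc cn.
  by have [-> -> ->] := max_sqr_dvdn_sum oa oc ob le_ab le_cb bn'.
have [le_ac|/ltnW le_ca] := leqP a c.
  exact: max_sqr_dvdn_sum le_ac (leq_trans le_ba le_ac) cn.
by have [-> -> ->] := max_sqr_dvdn_sum ob oc oa le_ba le_ca an'.
Qed.

Section IntegralFourier.
Variables (C : numClosedFieldType).

(** Squaring forgets the sign, so absolute values carry the problem from [C] to [nat]. *)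
Lemma is_integer_sqr (x : C) : is_integer x -> exists a : nat, x ^+ 2 = (a ^ 2)%:R.
Proof.
move=> [m ->]; exists `|m|%N.
by rewrite -abszX pmulrn gez0_abs ?sqr_ge0 // rmorphXn.
Qed.

Lemma row_norm2_nat n (s : 'M[C]_n.+1) i :
  integral_fourier s -> exists d : nat, row_norm2 s i = d%:R.
Proof.
case=> sint _ _ _ _; rewrite /row_norm2.
elim/big_ind: _ => [|_ _ [d ->] [e ->]|j _]; first by exists 0%N.
  by exists (d + e)%N; rewrite natrD.
by have [a ->] := is_integer_sqr (sint i j); exists (a ^ 2)%N.
Qed.

Lemma row_norm2_0 n (s : 'M[C]_n.+1) i :
  integral_fourier s -> row_norm2 s ord0 = row_norm2 s i * s ord0 i ^+ 2.
Proof.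
case=> _ [s0 _] _ sym _.
by have /(congr1 (fun x => x ^+ 2)) := sym i ord0; rewrite s0 mulr1 exprMn !sqrtCK.
Qed.

Lemma integral_fourier4_degree (s : 'M[C]_4) i :
  integral_fourier s -> s ord0 i ^+ 2 = 1.
Proof.
move=> sF; have [sint [s0 _] _ _ _] := sF.
have [a Ea] := is_integer_sqr (sint ord0 1).
have [b Eb] := is_integer_sqr (sint ord0 2%:R).
have [c Ec] := is_integer_sqr (sint ord0 3%:R).
have d0E : row_norm2 s ord0 = (1 + a ^ 2 + b ^ 2 + c ^ 2)%:R.
  rewrite /row_norm2 !big_ord_recl big_ord0 addr0 s0 expr1n !natrD -!addrA.
  rewrite -Ea -Eb -Ec; congr (_ + (_ ^+ 2 + (_ ^+ 2 + _ ^+ 2)));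
    by congr (s _ _); apply: val_inj.
(* The cofactor of [e ^ 2] is the squared norm of row [j], a natural number; the identity descends
   to [nat] because [C] has characteristic 0. *)
have dvd j (e : nat) : s ord0 j ^+ 2 = (e ^ 2)%:R ->
    (e ^ 2 %| 1 + a ^ 2 + b ^ 2 + c ^ 2)%N.
  move=> Ee; have [d Ed] := row_norm2_nat j sF.
  have /eqP := row_norm2_0 j sF; rewrite d0E Ed Ee -natrM eqr_nat => /eqP ->.
  exact: dvdn_mull.
have [a1 b1 c1] := sqr_dvdn_sum_eq1 (dvd _ _ Ea) (dvd _ _ Eb) (dvd _ _ Ec).
rewrite a1 in Ea; rewrite b1 in Eb; rewrite c1 in Ec.
case: i => -[|[|[|[|//]]]] lt_i4.
- by rewrite (_ : Ordinal _ = ord0) ?s0 ?expr1n //; apply: val_inj.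
- by rewrite -[RHS]Ea; congr (s _ _ ^+ 2); apply: val_inj.
- by rewrite -[RHS]Eb; congr (s _ _ ^+ 2); apply: val_inj.
- by rewrite -[RHS]Ec; congr (s _ _ ^+ 2); apply: val_inj.
Qed.

Lemma integral_fourier4_homogeneous (s : 'M[C]_4) :
  integral_fourier s -> homogeneous (arising_calgebra s).
Proof.
move=> sF; exists 1%N => // i _.
by rewrite [LHS]arising_degree_basis integral_fourier4_degree.
Qed.

End IntegralFourier.

Theorem theorem37 (R : realType) :
  (forall s : 'M[R[i]]_4,
     allen s -> ~ homogeneous (arising_calgebra s) -> ~ integral_fourier s)
  /\
  ~ (exists s : 'M[R[i]]_4,
       integral_fourier s /\ ~ homogeneous (arising_calgebra s)).
Proof.
split=> [s _ nonhom sF | [s [sF nonhom]]];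
  exact/nonhom/integral_fourier4_homogeneous.
Qed.
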